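(* Let $R$ be an integral domain, $n\geq 2$, $m\in(\mathbb{Z}/n\mathbb{Z})^\times$, $a,b\in R$ distinct, and suppose that the $n\times n$ Christoffel matrix $C_m(a,b)$ is invertible over $R$. Then its inverse is a Christoffel matrix over $R$. More precisely, let $m^{-1}$ be the inverse of $m$ in $(\mathbb{Z}/n\mathbb{Z})^\times$ and define $c,d,e,f\in R$ by \[C_m(a,b)\,C_{m^{-1}}(1,0)=C_1(c,d)\quad\text{and}\quad C_m(a,b)\,C_{m^{-1}}(0,1)=C_1(e,f).\] Then $cf-ed$ is a unit in $R$ and \[C_m(a,b)^{-1}=C_{m^{-1}}\bigl(f(fc-ed)^{-1},\,-d(fc-ed)^{-1}\bigr).\]
   Context: For $n\geq 2$, $(\mathbb{Z}/n\mathbb{Z})^\times$ denotes the multiplicative group of integers modulo $n$, identified with the set of integers in $\{0,1,\dots,n-1\}$ coprime to $n$. $0,1$ denote the additive and multiplicative identities of $R$ when used as matrix entries. A binary word on two distinct symbols $a,b$ (ordered formally by $a<b$) is a Christoffel word if it is Lyndon (strictly smaller lexicographically than all its other cyclic conjugates) and cyclically balanced (any two cyclic factors of the same length have numbers of occurrences of $a$ differing by at most $1$). For $m\in(\mathbb{Z}/n\mathbb{Z})^\times$, $c_m(a,b)$ denotes the Christoffel word of length $n$ on the distinct symbols $a,b$, beginning in $a$, with exactly $m$ occurrences of $a$ and $n-m$ occurrences of $b$. The Christoffel matrix $C_m(a,b)$ of size $n$ and type $m$ is the $n\times n$ matrix whose rows are the $n$ cyclic conjugates of $c_m(a,b)$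 arranged in increasing lexicographic order (relative to $a<b$), so that its first row is $c_m(a,b)$. Equivalently: the first column of $C_m(a,b)$ consists of $m$ entries $a$ followed by $n-m$ entries $b$, and each subsequent column is the cyclic downward shift by $m$ positions of the preceding column. In particular $C_1(a,b)$ has $a$ on the diagonal and $b$ elsewhere. A Christoffel matrix over $R$ is a matrix $C_m(a,b)$ with $a,b\in R$, $a\neq b$ (the order $a<b$ is purely formal). The product of two $n\times n$ Christoffel matrices over an integral domain of types $m_1$ and $m_2$ is a Christoffel matrix of type $m_1m_2 \bmod n$, so that $c,d,e,f$ are well defined. *)

(* Defs.v *)
From HB Require Import structures.
From mathcomp Require Import all_boot all_order all_algebra.

Set Implicit Arguments.
Unset Strict Implicit.
Unset Printing Implicit Defensive.

Import Order.TTheory GRing.Theory.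
Local Open Scope ring_scope.

(* Words on the formal symbols a < b are Boolean sequences: [false] stands   *)
(* for a and [true] for b, so that the canonical order of [bool] is a < b.   *)
(* Substituting ring elements for the symbols is delayed until               *)
(* [christoffel_mx], which keeps the order on the symbols purely formal.     *)

Definition lex_le (u v : seq bool) : bool :=
  ((u : seqlexi bool) <= (v : seqlexi bool))%O.

Definition lex_lt (u v : seq bool) : bool :=
  ((u : seqlexi bool) < (v : seqlexi bool))%O.

(* Strictness for every nontrivial rotation makes Lyndon words primitive.    *)
Definition lyndon (w : seq bool) : bool :=
  [forall i : 'I_(size w), (0 < i)%N ==> lex_lt w (rot i w)].

Definition cyclic_factor (w : seq bool) (i l : nat) : seq bool :=
  take l (rot i w).

Definition cyclically_balanced (w : seq bool) : bool :=
  [forall l : 'I_(size w).+1, forall i : 'I_(size w), forall j : 'I_(size w),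
     (count_mem false (cyclic_factor w i l)
        <= (count_mem false (cyclic_factor w j l)).+1)%N].

Definition is_christoffel_word (w : seq bool) : bool :=
  lyndon w && cyclically_balanced w.

(* The word c_m(a, b) of length n; it exists and is unique as soon as        *)
(* 1 < n, m < n and m is coprime to n. The default value is junk.            *)
Definition christoffel_word (n m : nat) : seq bool :=
  if [pick w : n.-tuple bool |
        [&& is_christoffel_word w, ohead w == Some false
          & count_mem false w == m]] is Some w
  then tval w else nseq n false.

Definition sorted_conjugates (w : seq bool) : seq (seq bool) :=
  sort lex_le [seq rot i w | i <- iota 0 (size w)].

(* ['Z_n] is the ring of integers modulo n only for 1 < n; its elements are  *)
(* the representatives in {0, ..., n - 1}.                                   *)
Definition unit_repr (n : nat) (m : {unit 'Z_n}) : nat :=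
  nat_of_ord (FinRing.uval m).

Definition christoffel_mx (R : Type) (n : nat) (m : {unit 'Z_n}) (a b : R) :
    'M[R]_n :=
  \matrix_(i < n, j < n)
    if nth false (nth [::] (sorted_conjugates
                              (christoffel_word n (unit_repr m))) i) j
    then b else a.

Definition is_christoffel_mx (R : eqType) (n : nat) (A : 'M[R]_n) : Prop :=
  exists (m : {unit 'Z_n}) (a b : R), a != b /\ A = christoffel_mx m a b.

(* Main.v *)
Require Import Defs.
From HB Require Import structures.
From mathcomp Require Import all_boot all_order all_algebra.
From mathcomp Require Import zify ring.
Set Implicit Arguments.
Unset Strict Implicit.
Unset Printing Implicit Defensive.
Import Order.TTheory GRing.Theory.
Local Open Scope ring_scope.

(** The matrix of type m has a closed form: its entry (i, j) is a exactly when
(i - m * j) mod n < m.  This follows from a description of balanced words.  In a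
balanced word of length n with m letters a, the number of letters a in any
cyclic factor of length l differs from the mean m * l / n by less than 1
([num_false_slope]).  So, along the word, n times the number of letters a read
so far minus m times the number of letters read stays in a window of n
consecutive integers; it rises by n - m on a letter a and drops by m on a letter
b, hence its position r in the window is reduced by m modulo n at each step, and
the letter to be read is a exactly when r < m ([balanced_rotation_word]).  The
word and all its conjugates are thus orbits of the rotation r |-> r - m of
Z/nZ, indexed by their starting point r; all starting points occur since m is
prime to n, and the lexicographic order is the order of the starting points
([sorted_conjugates_christoffel]).

Put k = m^-1, m * k = q * n + 1, and let P_m be the matrix of type m with a = 1
and b = 0, and J the all-one matrix.  Counting the letters a in a prefix of
length k of an orbit gives P_m * P_k = I + q * J
([sum_row_column_indicator]), while P_m and P_k have constant row and column
sums m and k.  By bilinearity C_m(a, b) * C_k(x, y) is an explicit C_1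
([mul_christoffel_mxV]); in particular c - d = f - e = a - b, and d + f is the
row sum S = n * b + m * (a - b) of C_m(a, b), so that c * f - e * d =
(a - b) * S.  Both factors are units when C_m(a, b) is invertible: the vector
of ones is an eigenvector for S, and the difference of two rows is divisible by
a - b.  Finally the claimed inverse gives the product C_1(1, 0) = I. *)

(** * Orbits of the rotation by - m on the integers modulo n *)

(** The state after j steps of r |-> r - m modulo n, written with n - m to avoid
negative numbers. *)
Definition rot_state (n m r j : nat) : nat := ((r + (n - m) * j) %% n)%N.

Lemma rot_state_add n m r i j :
  rot_state n m (rot_state n m r i) j = rot_state n m r (i + j).
Proof. by rewrite /rot_state modnDml mulnDr addnA. Qed.

Lemma rot_state0 n m r : (r < n)%N -> rot_state n m r 0 = r.
Proof. by move=> lt_rn; rewrite /rot_state muln0 addn0 modn_small. Qed.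

Lemma rot_state_lt n m r j : (0 < n)%N -> (rot_state n m r j < n)%N.
Proof. exact: ltn_pmod. Qed.

Lemma rot_state_step n m r : (m <= n)%N -> (r < n)%N ->
  rot_state n m r 1 = (if r < m then r + (n - m) else r - m)%N.
Proof.
move=> le_mn lt_rn; rewrite /rot_state muln1; case: ltnP => cmp_rm.
  by rewrite modn_small //; lia.
have -> : (r + (n - m) = (r - m) + n)%N by lia.
by rewrite modnDr modn_small //; lia.
Qed.

Lemma coprime_sub n m : (m <= n)%N -> coprime n m -> coprime n (n - m).
Proof.
move=> le_mn; rewrite coprime_sym /coprime -{1 2}(subnK le_mn) gcdnDr.
by rewrite [gcdn (_ + _) _]gcdnC gcdnDl gcdnC.
Qed.

(** When m is prime to n, so is n - m, and its multiples exhaust the integers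
modulo n: each orbit goes through all the states, once per period. *)
Lemma perm_rot_state n m r : coprime n m -> (0 < n)%N -> (m <= n)%N ->
  perm_eq [seq rot_state n m r i | i <- iota 0 n] (iota 0 n).
Proof.
move=> co_nm n_gt0 le_mn.
have co_n := coprime_sub le_mn co_nm.
suff inj : {in iota 0 n &, injective (rot_state n m r)}.
  have uniq_s : uniq [seq rot_state n m r i | i <- iota 0 n].
    by rewrite map_inj_in_uniq ?iota_uniq.
  apply: uniq_perm; rewrite ?iota_uniq //.
  have sub : {subset [seq rot_state n m r i | i <- iota 0 n] <= iota 0 n}.
    by move=> x /mapP[i _ ->]; rewrite mem_iota /= rot_state_lt.
  by have [|_ eq_mem] := uniq_min_size uniq_s sub; first rewrite size_map.
move=> i j; rewrite !mem_iota /= !add0n => lt_in lt_jn /eqP.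
rewrite /rot_state eqn_modDl.
wlog le_ij : i j lt_in lt_jn / (i <= j)%N.
  move=> W; case: (leqP i j) => [|/ltnW] le; first exact: W.
  by rewrite eq_sym => /W ->.
rewrite eq_sym eqn_mod_dvd ?leq_mul2l ?le_ij ?orbT // -mulnBr.
rewrite Gauss_dvdr // => /dvdnP[[|q] def_ji]; nia.
Qed.

(** * Words coded by an orbit *)

Lemma take_rot_mkseq (w : seq bool) i l : (i <= size w)%N -> (l <= size w)%N ->
  take l (rot i w) = mkseq (fun j => nth false w ((i + j) %% size w)) l.
Proof.
move=> le_i le_l; have sz : size (take l (rot i w)) = l.
  by rewrite size_takel ?size_rot.
apply: (@eq_from_nth _ false) => [|j]; rewrite sz ?size_mkseq // => lt_jl.
rewrite nth_take // nth_mkseq // /rot nth_cat size_drop nth_drop.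
case: ltnP => cmp; first by rewrite modn_small //; lia.
rewrite nth_take; last by lia.
have -> : (i + j = (j - (size w - i)) + size w)%N by lia.
by rewrite modnDr modn_small //; lia.
Qed.

Definition rotation_word (n m r : nat) : seq bool :=
  mkseq (fun j => m <= rot_state n m r j)%N n.

Lemma size_rotation_word n m r : size (rotation_word n m r) = n.
Proof. exact: size_mkseq. Qed.

Lemma nth_rotation_word_mod n m r j : (0 < n)%N ->
  nth false (rotation_word n m r) (j %% n) = (m <= rot_state n m r j)%N.
Proof.
move=> n_gt0; rewrite nth_mkseq ?ltn_pmod // /rot_state.
by rewrite -modnDmr modnMmr modnDmr.
Qed.

Lemma take_rot_rotation_word n m r i l :
  (0 < n)%N -> (i <= n)%N -> (l <= n)%N ->
  take l (rot i (rotation_word n m r))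
    = mkseq (fun j => m <= rot_state n m (rot_state n m r i) j)%N l.
Proof.
move=> n_gt0 le_in le_ln; rewrite take_rot_mkseq ?size_rotation_word //.
by apply: eq_mkseq => j; rewrite nth_rotation_word_mod // rot_state_add.
Qed.

Lemma rot_rotation_word n m r i : (0 < n)%N -> (i <= n)%N ->
  rot i (rotation_word n m r) = rotation_word n m (rot_state n m r i).
Proof.
move=> n_gt0 le_in.
rewrite [RHS]/rotation_word -take_rot_rotation_word // take_oversize //.
by rewrite size_rot size_rotation_word.
Qed.

(** As long as two orbits code the same letters, their states move by the same
amount and keep their order; where the letters first differ, the smaller state
is the one below m, which reads a.  The length l is kept independent of n for
the sake of induction. *)
Lemma rot_state_orbit_le n m r r' l : (m <= n)%N -> (r <= r' < n)%N ->
  lex_le (mkseq (fun j => m <= rot_state n m r j)%N l)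
         (mkseq (fun j => m <= rot_state n m r' j)%N l).
Proof.
move=> le_mn; elim: l r r' => [//|l IHl] r r' /andP[le_rr' lt_r'n].
have cons s : (s < n)%N -> mkseq (fun j => m <= rot_state n m s j)%N l.+1
  = (m <= s)%N :: mkseq (fun j => m <= rot_state n m (rot_state n m s 1) j)%N l.
  move=> lt_sn; rewrite /mkseq /= rot_state0 // (iotaDl 1 0) -map_comp.
  by congr (_ :: _); apply: eq_map => j /=; rewrite rot_state_add.
have lt_rn := leq_ltn_trans le_rr' lt_r'n.
rewrite !cons // /lex_le lexi_cons; apply/andP; split.
  by rewrite leEbool; case: (leqP m r) => [/(leq_trans)->|].
apply/implyP; rewrite leEbool => same; apply: IHl.
rewrite !rot_state_step //.
by move: same; case: (ltnP r); case: (ltnP r') => //; lia.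
Qed.

Lemma rotation_word_le n m r r' : (m <= n)%N -> (r <= r' < n)%N ->
  lex_le (rotation_word n m r) (rotation_word n m r').
Proof. exact: rot_state_orbit_le. Qed.

(** Each step adds n - m or - m to the state, according to the letter read;
summing over l steps turns the number of letters a into a difference of two
states. *)
Lemma count_rot_state n m r l : (m <= n)%N -> (r < n)%N ->
  (n * count_mem false (mkseq (fun j => m <= rot_state n m r j) l) + r
    = m * l + rot_state n m r l)%N.
Proof.
move=> le_mn lt_rn; have n_gt0 : (0 < n)%N by lia.
elim: l => [|l IHl]; first by rewrite rot_state0 // !muln0.
rewrite mkseqS -cats1 count_cat /= addn0 -addn1 -(rot_state_add n m r l).
rewrite rot_state_step ?rot_state_lt // !mulnDr muln1.
move: (rot_state_lt m r l n_gt0) IHl.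
set c := (n * _)%N; set s := rot_state n m r l.
by case: (ltnP s m) => cmp lt_sn IHl; rewrite ?muln1 ?muln0; lia.
Qed.

Lemma rotation_word_inj n m r r' : coprime n m -> (0 < m <= n)%N ->
  (r < n)%N -> (r' < n)%N ->
  rotation_word n m r = rotation_word n m r' -> r = r'.
Proof.
move=> co_nm /andP[m_gt0 le_mn] lt_rn lt_r'n eq_w.
have n_gt0 : (0 < n)%N by lia.
have {}eq_w j : (m <= rot_state n m r j)%N = (m <= rot_state n m r' j)%N.
  by rewrite -!nth_rotation_word_mod // eq_w.
wlog lt_rr' : r r' lt_rn lt_r'n eq_w / (r < r')%N.
  move=> W; case: (ltngtP r r') => // cmp; first exact: W.
  by apply/esym/W.
(* Equal letters keep the distance between the two states constant, but the  *)
(* orbit of the smaller one reaches n - 1, which leaves no room above it.    *)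
have dist j : (rot_state n m r j + (r' - r) = rot_state n m r' j)%N.
  elim: j => [|j IHj]; first by rewrite !rot_state0 //; lia.
  rewrite -addn1 -!rot_state_add !rot_state_step ?rot_state_lt //.
  move: (eq_w j) (IHj); case: (ltnP (rot_state n m r j)) => //;
    by case: (ltnP (rot_state n m r' j)) => //; lia.
have /mapP[j _ top] : n.-1 \in [seq rot_state n m r i | i <- iota 0 n].
  by rewrite (perm_mem (perm_rot_state _ _ _ _)) // mem_iota; lia.
by have := rot_state_lt m r' j n_gt0; have := dist j; lia.
Qed.

Lemma count_rotation_word n m r : (m <= n)%N -> (r < n)%N ->
  count_mem false (rotation_word n m r) = m.
Proof.
move=> le_mn lt_rn; have := count_rot_state n le_mn lt_rn.
rewrite {2}/rot_state -modnDmr modnMl addn0 modn_small //.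
rewrite -/(rotation_word n m r).
by move/addIn; rewrite mulnC => /eqP; rewrite eqn_pmul2r => [/eqP|]; lia.
Qed.

(** By [count_rot_state], n times the difference of the two counts is a
difference of four states, hence less than 2 * n. *)
Lemma cyclically_balanced_rotation_word n m r : (m <= n)%N -> (r < n)%N ->
  cyclically_balanced (rotation_word n m r).
Proof.
move=> le_mn lt_rn; have n_gt0 : (0 < n)%N by lia.
rewrite /cyclically_balanced size_rotation_word.
apply/forallP=> -[l le_ln] /=; apply/forallP=> -[i lt_in] /=.
apply/forallP=> -[j lt_jn] /=.
rewrite /cyclic_factor !take_rot_rotation_word //; try lia.
have := count_rot_state l le_mn (rot_state_lt m r i n_gt0).
have := count_rot_state l le_mn (rot_state_lt m r j n_gt0).
have := rot_state_lt m r i n_gt0; have := rot_state_lt m r j n_gt0.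
have := rot_state_lt m (rot_state n m r i) l n_gt0.
have := rot_state_lt m (rot_state n m r j) l n_gt0.
set ci := count _ _; set cj := count _ _ => *; nia.
Qed.

(** This word is the first of the list of its conjugates, all of which are
distinct. *)
Lemma christoffel_rotation_word n m : coprime n m -> (0 < m <= n)%N ->
  is_christoffel_word (rotation_word n m 0).
Proof.
move=> co_nm /andP[m_gt0 le_mn]; have n_gt0 : (0 < n)%N by lia.
rewrite /is_christoffel_word cyclically_balanced_rotation_word // andbT.
apply/forallP=> -[i /= +]; rewrite size_rotation_word => lt_in.
apply/implyP=> i_gt0; rewrite rot_rotation_word ?(ltnW lt_in) //.
have lt_s := rot_state_lt m 0 i n_gt0.
have le_w := @rotation_word_le n m 0 _ le_mn lt_s.
rewrite /lex_lt lt_neqAle [(_ <= _)%O]le_w andbT; apply/eqP.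
move/(rotation_word_inj co_nm) => /(_ _ n_gt0 lt_s)/[!m_gt0] /(_ le_mn).
rewrite /rot_state add0n => /esym/eqP; rewrite -/(dvdn _ _) Gauss_dvdr.
  by move=> /(dvdn_leq i_gt0); lia.
exact: coprime_sub.
Qed.

(** * Balanced words are coded by orbits *)

(** Counting in the periodic word w w w ... makes windows additive without any
restriction on their position and length. *)
Definition num_false (w : seq bool) (i l : nat) : nat :=
  \sum_(j < l) ~~ nth false w ((i + j) %% size w).

Lemma num_falseD w i l l' :
  num_false w i (l + l') = (num_false w i l + num_false w (i + l) l')%N.
Proof.
rewrite /num_false big_split_ord /=; congr (_ + _)%N.
by apply: eq_bigr => j _; rewrite addnA.
Qed.

Lemma num_false_mod w i l : num_false w (i %% size w) l = num_false w i l.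
Proof. by apply: eq_bigr => j _; rewrite modnDml. Qed.

Lemma num_falseE w i l : (i < size w)%N -> (l <= size w)%N ->
  num_false w i l = count_mem false (cyclic_factor w i l).
Proof.
move=> lt_i le_l; rewrite /cyclic_factor take_rot_mkseq ?(ltnW lt_i) //.
rewrite count_map -sumn_count sumnE big_map -[in RHS](subn0 l) big_mkord.
by apply: eq_bigr => j _ /=; case: nth.
Qed.

Lemma num_false_size w i : num_false w i (size w) = count_mem false w.
Proof.
case: (posnP (size w)) => [w0|w_gt0].
  by rewrite (size0nil w0) /num_false big_ord0.
rewrite -num_false_mod num_falseE ?ltn_pmod // /cyclic_factor take_oversize.
  by apply/permP; rewrite perm_rot.
by rewrite size_rot.
Qed.

Lemma num_false_periods w i k :
  num_false w i (k * size w) = (k * count_mem false w)%N.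
Proof.
elim: k => [|k IHk]; first by rewrite /num_false big_ord0.
by rewrite mulSnr num_falseD IHk num_false_size mulSnr.
Qed.

Lemma num_false_balanced w i j l : (0 < size w)%N -> cyclically_balanced w ->
  (l <= size w)%N -> (num_false w i l <= (num_false w j l).+1)%N.
Proof.
move=> w_gt0 /forallP bal le_l.
rewrite -[leqLHS]num_false_mod -(num_false_mod w j).
have lt_i : (i %% size w < size w)%N by rewrite ltn_pmod.
have lt_j : (j %% size w < size w)%N by rewrite ltn_pmod.
rewrite !num_falseE //.
have := bal (Ordinal (le_l : l < (size w).+1)%N).
by move=> /forallP/(_ (Ordinal lt_i))/forallP/(_ (Ordinal lt_j)).
Qed.

(** Compare with n consecutive windows of length l, of which this is the first:
they cover l periods, which contain l * m letters a, and the counts in the n - 1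
other windows are off by at most one each. *)
Lemma num_false_slope w i l (n := size w) (m := count_mem false w) :
    (0 < n)%N -> cyclically_balanced w -> (l <= n)%N ->
  (n * num_false w i l < m * l + n)%N /\ (m * l < n * num_false w i l + n)%N.
Proof.
move=> n_gt0 bal le_ln; set c := num_false w i l.
have blocks t : (t.+1 * c <= num_false w i (t.+1 * l) + t)%N /\
                (num_false w i (t.+1 * l) <= t.+1 * c + t)%N.
  elim: t => [|t IHt]; first by rewrite !mul1n -/c; lia.
  rewrite [(t.+2 * l)%N]mulSnr num_falseD.
  have := num_false_balanced i (i + t.+1 * l) n_gt0 bal le_ln.
  have := num_false_balanced (i + t.+1 * l) i n_gt0 bal le_ln.
  by rewrite -/c; lia.
have := blocks n.-1; rewrite prednK // [(n * l)%N]mulnC num_false_periods.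
by rewrite -/m (mulnC l); lia.
Qed.

(** The state before the letter j is r + n * (num_false w 0 j) - m * j, where r
is the least number that makes all these values nonnegative; [num_false_slope]
bounds the values by n - 1. *)
Lemma balanced_rotation_word w (n := size w) (m := count_mem false w) :
    (0 < n)%N -> cyclically_balanced w ->
  exists2 r, (r < n)%N & w = rotation_word n m r.
Proof.
move=> n_gt0 bal.
have le_mn : (m <= n)%N by exact: count_size.
(* Truncation does not affect the maximum: the value at i = 0 is 0. *)
pose F (i : 'I_n.+1) := (m * i - n * num_false w 0 i)%N.
pose r := (\max_i F i)%N.
have low i : (i <= n)%N -> (m * i <= r + n * num_false w 0 i)%N.
  move=> le_in; pose i' := Ordinal (le_in : i < n.+1)%N.
  by have := leq_bigmax i' : (F i' <= r)%N; rewrite /F /=; lia.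
have high i : (i <= n)%N -> (r + n * num_false w 0 i < m * i + n)%N.
  move=> le_in; have [i0 def_r] : {i0 | r = F i0}.
    by apply: bigop.eq_bigmax; rewrite card_ord.
  have le_i0n : (i0 <= n)%N by rewrite -ltnS.
  case: (posnP r) => [r0|r_gt0].
    by have [+ _] := num_false_slope 0 n_gt0 bal le_in; rewrite -/n -/m; lia.
  move: def_r r_gt0; rewrite /F => -> r_gt0; case: (leqP i0 i) => cmp.
    have le_d : (i - i0 <= n)%N by lia.
    have [+ _] := num_false_slope i0 n_gt0 bal le_d.
    have := num_falseD w 0 i0 (i - i0); rewrite subnKC // add0n -/n -/m; nia.
  have le_d : (i0 - i <= n)%N by lia.
  have [_ +] := num_false_slope i n_gt0 bal le_d.
  have := num_falseD w 0 i (i0 - i).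
  rewrite (subnKC (ltnW cmp)) add0n -/n -/m; nia.
have lt_rn : (r < n)%N.
  by have := high 0%N isT; rewrite /num_false big_ord0; lia.
have state i : (i <= n)%N ->
    (m * i + rot_state n m r i)%N = (r + n * num_false w 0 i)%N.
  move=> le_in; have lo := low i le_in; have hi := high i le_in.
  have -> : rot_state n m r i = (r + n * num_false w 0 i - m * i)%N; last lia.
  rewrite /rot_state -(modnMDl (num_false w 0 i)).
  have -> : (num_false w 0 i * n + (r + (n - m) * i)
              = i * n + (r + n * num_false w 0 i - m * i))%N by nia.
  by rewrite modnMDl modn_small //; lia.
exists r => //; apply: (@eq_from_nth _ false) => [|j lt_jn].
  by rewrite size_rotation_word.
rewrite nth_mkseq //.
have next : num_false w 0 j.+1 = (num_false w 0 j + ~~ nth false w j)%N.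
  by rewrite /num_false big_ord_recr /= add0n modn_small.
have := state j.+1 lt_jn; have := state j (ltnW lt_jn).
have := rot_state_lt m r j n_gt0; have := rot_state_lt m r j.+1 n_gt0.
by rewrite next; case: (nth _ _ _); case: leqP => //=; nia.
Qed.

(** * Closed form of the Christoffel matrices *)

Lemma sorted_conjugates_rotation_word n m r : coprime n m -> (0 < m <= n)%N ->
  (r < n)%N ->
  sorted_conjugates (rotation_word n m r) = mkseq (rotation_word n m) n.
Proof.
move=> co_nm /andP[m_gt0 le_mn] lt_rn; have n_gt0 : (0 < n)%N by lia.
apply: (@sorted_eq _ lex_le).
- by move=> u v w; apply: le_trans.
- by move=> u v; apply: le_anti.
- by apply: sort_sorted => u v; apply: le_total.
- apply: (@homo_sorted_in _ _ (gtn n) (rotation_word n m) leq) => /=.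
  + by move=> i j _ lt_jn le_ij; apply: rotation_word_le; rewrite ?le_ij.
  + by apply/allP => i; rewrite mem_iota.
  + exact: iota_sorted.
rewrite perm_sort size_rotation_word.
have -> : [seq rot i (rotation_word n m r) | i <- iota 0 n]
        = map (rotation_word n m) [seq rot_state n m r i | i <- iota 0 n].
  rewrite -map_comp; apply/eq_in_map => i; rewrite mem_iota => /= lt_in.
  by rewrite rot_rotation_word // ltnW.
exact/perm_map/perm_rot_state.
Qed.

(** Any balanced word with the right content has these conjugates, so the word
that is picked need not be identified; the word of the orbit of 0 shows that
the choice is not from an empty set. *)
Lemma sorted_conjugates_christoffel n m : coprime n m -> (0 < m < n)%N ->
  sorted_conjugates (christoffel_word n m) = mkseq (rotation_word n m) n.
Proof.
move=> co_nm /andP[m_gt0 lt_mn]; have n_gt0 : (0 < n)%N by lia.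
rewrite /christoffel_word.
case: pickP => [w /and3P[/andP[_ bal] _ /eqP cnt_w]|none].
  have w_gt0 : (0 < size w)%N by rewrite size_tuple.
  have [r] := balanced_rotation_word w_gt0 bal; rewrite size_tuple cnt_w.
  move=> lt_rn ->; apply: sorted_conjugates_rotation_word => //.
  by rewrite m_gt0 ltnW.
have sz_w : size (rotation_word n m 0) == n by rewrite size_rotation_word.
have := none (Tuple sz_w); rewrite /= christoffel_rotation_word //;
  last by rewrite m_gt0 ltnW.
rewrite count_rotation_word ?(ltnW lt_mn) // eqxx.
by case: (n) n_gt0 => // n' _; rewrite /= rot_state0 // leqNgt m_gt0.
Qed.

Lemma unit_repr_lt n (m : {unit 'Z_n}) : (1 < n)%N -> (unit_repr m < n)%N.
Proof. by move=> n_gt1; rewrite -[ltnRHS](Zp_cast n_gt1) ltn_ord. Qed.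

Lemma coprime_unit_repr n (m : {unit 'Z_n}) :
  (1 < n)%N -> coprime n (unit_repr m).
Proof. by move=> n_gt1; rewrite -unitZpE // natr_Zp (valP m). Qed.

Lemma unit_repr_gt0 n (m : {unit 'Z_n}) : (1 < n)%N -> (0 < unit_repr m)%N.
Proof.
move=> n_gt1; have := coprime_unit_repr m n_gt1.
by case: (unit_repr m) => //; rewrite /coprime gcdn0; lia.
Qed.

Lemma unit_repr1 n : unit_repr (1%g : {unit 'Z_n}) = 1%N.
Proof. by []. Qed.

Lemma unit_reprV n (m : {unit 'Z_n}) : (1 < n)%N ->
  (unit_repr m * unit_repr (m^-1)%g
     = unit_repr m * unit_repr (m^-1)%g %/ n * n + 1)%N.
Proof.
move=> n_gt1; rewrite {1}(divn_eq (unit_repr m * unit_repr (m^-1)%g) n).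
congr (_ + _)%N; rewrite -(val_Zp_nat n_gt1) natrM !natr_Zp.
have -> : FinRing.uval m * FinRing.uval (m^-1)%g = FinRing.uval (m * m^-1)%g
  by [].
by rewrite mulgV.
Qed.

Lemma christoffel_mxE (R : Type) n (m : {unit 'Z_n}) (a b : R) (i j : 'I_n) :
  (1 < n)%N -> christoffel_mx m a b i j
    = if (rot_state n (unit_repr m) i j < unit_repr m)%N then a else b.
Proof.
move=> n_gt1; rewrite mxE sorted_conjugates_christoffel.
- by rewrite nth_mkseq // nth_mkseq // leqNgt if_neg.
- exact: coprime_unit_repr.
- by rewrite unit_repr_gt0 // unit_repr_lt.
Qed.

(** * Products of 0/1 Christoffel matrices *)

Lemma sum_rot_state n m r l : 
  (\sum_(j < l) (rot_state n m r j < m))%N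
    = count_mem false (mkseq (fun j => m <= rot_state n m r j)%N l).
Proof.
rewrite count_map -sumn_count sumnE big_map -[in RHS](subn0 l) big_mkord.
by apply: eq_bigr => j _ /=; case: ltnP.
Qed.

Lemma sum_row_indicator n m r : (m <= n)%N -> (r < n)%N ->
  (\sum_(j < n) (rot_state n m r j < m))%N = m.
Proof. by move=> le_mn lt_rn; rewrite sum_rot_state count_rotation_word. Qed.

(** The cyclic shift is the orbit of c under the rotation by - (n - 1) = 1. *)
Lemma sum_shift n c (F : nat -> nat) : (0 < n)%N ->
  (\sum_(j < n) F ((c + j) %% n) = \sum_(j < n) F j)%N.
Proof.
move=> n_gt0; have co_n : coprime n n.-1.
  by rewrite -{1}(prednK n_gt0) coprimeSn.
rewrite -(big_mkord xpredT (fun j => F ((c + j) %% n)%N)) -(big_mkord xpredT F).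
rewrite /index_iota subn0.
rewrite -[RHS](perm_big _ (perm_rot_state c co_n n_gt0 (leq_pred n))) big_map.
by apply: eq_bigr => j _; rewrite /rot_state -subn1 subKn // mul1n.
Qed.

Lemma sum_column_indicator n k l : (k <= n)%N -> (0 < n)%N ->
  (\sum_(j < n) (rot_state n k j l < k))%N = k.
Proof.
move=> le_kn n_gt0; rewrite /rot_state.
under eq_bigr do rewrite addnC.
rewrite (sum_shift _ (fun x => x < k)%N n_gt0) //.
rewrite -[RHS]card_ord -sum1_card (big_ord_widen n (fun=> 1%N) le_kn).
by rewrite [RHS]big_mkcond; apply: eq_bigr => j _ /=; case: ltnP.
Qed.

Lemma rot_state1 n i j : (i < n)%N -> (j < n)%N ->
  rot_state n 1 i j = (if j <= i then i - j else n + i - j)%N.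
Proof.
move=> lt_in lt_jn; rewrite /rot_state; case: leqP => cmp.
  have -> : (i + (n - 1) * j = j * n + (i - j))%N by nia.
  by rewrite modnMDl modn_small //; lia.
have -> : (i + (n - 1) * j = j.-1 * n + (n + i - j))%N by nia.
by rewrite modnMDl modn_small //; lia.
Qed.

Lemma rot_state1_lt1 n i j : (i < n)%N -> (j < n)%N ->
  (rot_state n 1 i j < 1)%N = (i == j).
Proof.
by move=> lt_in lt_jn; rewrite rot_state1 //; case: (leqP j i) => ?; lia.
Qed.

(** This is P_m * P_k = I + q * J, entrywise.  Writing j = k * l + u, the second
factor selects u < k, and the first one becomes the condition on the state after
u steps from t = i - l, since m * k = 1 modulo n.  So the sum counts the letters
a among the first k letters of the orbit of t; as k steps of - m amount to one
step of - 1, [count_rot_state] yields q, plus 1 when the step wraps around, that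
is when t = 0. *)
Lemma sum_row_column_indicator n m k q i l : (m <= n)%N -> (k <= n)%N ->
    (m * k = q * n + 1)%N -> (i < n)%N -> (l < n)%N ->
  (\sum_(j < n) (rot_state n m i j < m) * (rot_state n k j l < k)
     = q + (i == l))%N.
Proof.
move=> le_mn le_kn mkE lt_in lt_ln; have n_gt0 : (0 < n)%N by lia.
pose F j := ((rot_state n m i j < m) * (rot_state n k j l < k))%N.
rewrite -[LHS](sum_shift (k * l) F n_gt0) /F.
set t := rot_state n 1 i l.
have lt_tn : (t < n)%N by apply: rot_state_lt.
have first_factor u : rot_state n m i ((k * l + u) %% n) = rot_state n m t u.
  rewrite /t /rot_state modnDml -modnDmr modnMmr modnDmr.
  rewrite -(modnMDl (q * l + l)) -[RHS](modnMDl (k * l)); congr (_ %% n)%N.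
  have [d defd] : {d | n = m + d}%N by exists (n - m)%N; lia.
  have [p defp] : {p | n = p + 1}%N by exists (n - 1)%N; lia.
  have -> : (n - m = d)%N by lia.
  have -> : (n - 1 = p)%N by lia.
  have := congr1 (muln l) mkE.
  have := congr1 (muln (k * l)) defd.
  have := congr1 (muln l) defp; clear -mkE; nia.
have second_factor u : (u < n)%N -> rot_state n k ((k * l + u) %% n) l = u.
  move=> lt_un; rewrite /rot_state modnDml.
  have -> : (k * l + u + (n - k) * l = l * n + u)%N by nia.
  by rewrite modnMDl modn_small.
transitivity (\sum_(u < k) (rot_state n m t u < m))%N.
  rewrite (big_ord_widen n (fun u => (rot_state n m t u < m) : nat) le_kn).
  rewrite [RHS]big_mkcond; apply: eq_bigr => u _.
  rewrite first_factor second_factor //.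
  by case: (u < k)%N; rewrite ?muln0 ?muln1.
rewrite sum_rot_state.
have := count_rot_state k le_mn lt_tn; set c := count _ _.
have -> : rot_state n m t k = (if t == 0 then n - 1 else t - 1)%N.
  rewrite /rot_state -(modnMDl q).
  have k_gt0 : (0 < k)%N by case: (k) mkE; lia.
  have -> : (q * n + (t + (n - m) * k) = (k - 1) * n + (n + t - 1))%N.
    have := congr1 (addn (k * (n - m))) mkE.
    rewrite (mulnC m k) -mulnDr subnK //.
    rewrite (mulnC (n - m)%N) [((k - 1) * n)%N]mulnBl mul1n.
    by have := leq_pmull n k_gt0; lia.
  rewrite modnMDl; case: eqP => [->|/eqP t_neq0].
    by rewrite addn0 modn_small; lia.
  have -> : (n + t - 1 = 1 * n + (t - 1))%N by lia.
  by rewrite modnMDl modn_small; lia.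
rewrite -(rot_state1_lt1 lt_in lt_ln) -/t mkE.
case: (posnP t) => [->|t_gt0]; first by nia.
have -> : (t < 1)%N = false by lia.
nia.
Qed.

(** * Products and units *)

Lemma christoffel_mx_lin (R : zmodType) n (m : {unit 'Z_n}) (a b : R) i j :
  (1 < n)%N ->
  christoffel_mx m a b i j
    = b + (a - b) *+ (rot_state n (unit_repr m) i j < unit_repr m)%N.
Proof.
move=> n_gt1; rewrite christoffel_mxE //.
by case: ifP; rewrite ?mulr1n ?mulr0n ?addr0 // addrC subrK.
Qed.

Lemma mul_christoffel_mxV (R : pzRingType) n (m : {unit 'Z_n}) (a b x y : R)
    (k := unit_repr (m^-1)%g) (q := (unit_repr m * k %/ n)%N)
    (s := b * y * n%:R + b * (x - y) * k%:R + (a - b) * y * (unit_repr m)%:R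
           + (a - b) * (x - y) * q%:R) :
  (1 < n)%N ->
  christoffel_mx m a b *m christoffel_mx (m^-1)%g x y
    = christoffel_mx (1%g : {unit 'Z_n}) (s + (a - b) * (x - y)) s.
Proof.
move=> n_gt1; apply/matrixP => i l; rewrite mxE christoffel_mx_lin //.
have n_gt0 := ltnW n_gt1.
have le_mn := ltnW (unit_repr_lt m n_gt1).
have le_kn := ltnW (unit_repr_lt (m^-1)%g n_gt1).
rewrite unit_repr1 rot_state1_lt1 //.
under eq_bigr => j _.
  rewrite !christoffel_mx_lin // mulrDl !mulrDr !mulrnAl !mulrnAr -mulrnA.
  rewrite addrA mulnC; over.
rewrite !big_split /= sumr_const card_ord !sumrMnr.
rewrite sum_column_indicator // sum_row_indicator //.
rewrite (sum_row_column_indicator le_mn le_kn (unit_reprV m n_gt1)) //.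
by rewrite mulrnDr addrA -/k -/q /s !mulr_natr [_ + _ - _]addrC addKr.
Qed.

Lemma christoffel_mx1_inj (R : Type) n (c d c' d' : R) : (1 < n)%N ->
  christoffel_mx (1%g : {unit 'Z_n}) c d
    = christoffel_mx (1%g : {unit 'Z_n}) c' d' ->
  c = c' /\ d = d'.
Proof.
move=> n_gt1 eq_mx; pose i0 := Ordinal (ltnW n_gt1); pose i1 := Ordinal n_gt1.
have entry (i j : 'I_n) : (if i == j :> nat then c else d)
                        = (if i == j :> nat then c' else d').
  have := congr1 (fun A : 'M[R]_n => A i j) eq_mx.
  by rewrite !christoffel_mxE // unit_repr1 rot_state1_lt1.
by split; [exact: (entry i0 i0) | exact: (entry i0 i1)].
Qed.

Lemma christoffel_mx1_10 (R : pzSemiRingType) n : (1 < n)%N ->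
  christoffel_mx (1%g : {unit 'Z_n}) 1 0 = 1%:M :> 'M[R]_n.
Proof.
move=> n_gt1; apply/matrixP => i j.
rewrite christoffel_mxE // unit_repr1 rot_state1_lt1 // mxE -val_eqE.
by case: eqP.
Qed.

(** In the identity C * C^-1 = I, take the difference of two rows: the rows of C
differ by a multiple of a - b, and an entry of the difference of the rows of I
is 1. *)
Lemma unit_christoffel_diff (R : comUnitRingType) n (m : {unit 'Z_n})
    (a b : R) :
  (1 < n)%N ->
  christoffel_mx m a b \in unitmx -> a - b \is a GRing.unit.
Proof.
move=> n_gt1 inv; set C := christoffel_mx m a b in inv.
pose i0 := Ordinal (ltnW n_gt1); pose i1 := Ordinal n_gt1.
pose p i j := (rot_state n (unit_repr m) i j < unit_repr m)%N.
have CE i j : C i j = b + (a - b) *+ p i j by exact: christoffel_mx_lin.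
have row i : (1%:M : 'M[R]_n) i i0 = \sum_j C i j * invmx C j i0.
  by rewrite -(mulmxV inv) mxE.
apply/unitrPr; exists (\sum_(j < n) ((p i0 j)%:R - (p i1 j)%:R) * invmx C j i0).
transitivity ((1%:M : 'M[R]_n) i0 i0 - (1%:M : 'M[R]_n) i1 i0);
  last by rewrite !mxE subr0.
rewrite !row -sumrB mulr_sumr; apply: eq_bigr => j _.
by rewrite mulrA mulrBr !mulr_natr -mulrBl !CE [b + _ *+ p i0 j]addrC addrKA.
Qed.

(** The row sums of C are all equal to this element S, so each row of C^-1 has
a sum s with s * S = 1, read off from the row sums of C^-1 * C = I. *)
Lemma unit_christoffel_row_sum (R : comUnitRingType) n (m : {unit 'Z_n})
    (a b : R) :
  (1 < n)%N ->
  christoffel_mx m a b \in unitmx ->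
  b * n%:R + (a - b) * (unit_repr m)%:R \is a GRing.unit.
Proof.
move=> n_gt1 inv; set C := christoffel_mx m a b in inv.
have row_sum i : \sum_j C i j = b * n%:R + (a - b) * (unit_repr m)%:R.
  under eq_bigr do rewrite christoffel_mx_lin //.
  rewrite big_split /= sumr_const card_ord sumrMnr !mulr_natr.
  rewrite sum_row_indicator //.
  by rewrite ltnW // unit_repr_lt.
pose i0 := Ordinal (ltnW n_gt1).
apply/unitrPr; exists (\sum_i invmx C i0 i); rewrite mulr_sumr.
transitivity (\sum_j (1%:M : 'M[R]_n) i0 j); last first.
  rewrite (bigD1 i0) //= big1 => [|j /negPf]; rewrite !mxE ?eqxx ?addr0 //.
  by rewrite eq_sym => ->.
rewrite -(mulVmx inv); under [RHS]eq_bigr do rewrite mxE.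
rewrite exchange_big; apply: eq_bigr => i _ /=.
by rewrite -mulr_sumr row_sum mulrC.
Qed.

Theorem lemma3 (R : idomainType) (n : nat) (m : {unit 'Z_n}) (a b : R)
    (hn : (1 < n)%N) (hab : a != b)
    (hinv : christoffel_mx m a b \in unitmx) :
  [/\ is_christoffel_mx (invmx (christoffel_mx m a b)),
      (exists c d : R, c != d /\
         christoffel_mx m a b *m christoffel_mx (m^-1)%g 1 0
           = christoffel_mx (1%g : {unit 'Z_n}) c d),
      (exists e f : R, e != f /\
         christoffel_mx m a b *m christoffel_mx (m^-1)%g 0 1
           = christoffel_mx (1%g : {unit 'Z_n}) e f)
    & forall c d e f : R,
        christoffel_mx m a b *m christoffel_mx (m^-1)%g 1 0
          = christoffel_mx (1%g : {unit 'Z_n}) c d ->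
        christoffel_mx m a b *m christoffel_mx (m^-1)%g 0 1
          = christoffel_mx (1%g : {unit 'Z_n}) e f ->
        c * f - e * d \is a GRing.unit /\
        invmx (christoffel_mx m a b)
          = christoffel_mx (m^-1)%g
              (f * (f * c - e * d)^-1) (- d * (f * c - e * d)^-1)].
Proof.
pose k := unit_repr (m^-1)%g; pose q := (unit_repr m * k %/ n)%N.
pose S := b * n%:R + (a - b) * (unit_repr m)%:R.
pose d := b * k%:R + (a - b) * q%:R; pose f := S - d.
pose c := d + (a - b); pose e := f - (a - b).
(* The product is linear in (x, y), so (1, 0) and (0, 1) determine it. *)
have prod x y : christoffel_mx m a b *m christoffel_mx (m^-1)%g x y
    = christoffel_mx (1%g : {unit 'Z_n}) (x * c + y * e) (x * d + y * f).
  rewrite mul_christoffel_mxV // -/k -/q.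
  by congr (christoffel_mx _ _ _); rewrite /e /c /f /S /d; ring.
have prod10 : christoffel_mx m a b *m christoffel_mx (m^-1)%g 1 0
    = christoffel_mx (1%g : {unit 'Z_n}) c d.
  by rewrite prod !mul1r !mul0r !addr0.
have prod01 : christoffel_mx m a b *m christoffel_mx (m^-1)%g 0 1
    = christoffel_mx (1%g : {unit 'Z_n}) e f.
  by rewrite prod !mul1r !mul0r !add0r.
have DE : f * c - e * d = (a - b) * S by rewrite /c /e /f; ring.
have unit_D : f * c - e * d \is a GRing.unit.
  by rewrite DE unitrM (unit_christoffel_diff hn hinv) unit_christoffel_row_sum.
set D := f * c - e * d in DE unit_D.
have invE : invmx (christoffel_mx m a b)
    = christoffel_mx (m^-1)%g (f * D^-1) (- d * D^-1).
  rewrite -[RHS](mulKmx hinv) prod.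
  have -> : f * D^-1 * c + - d * D^-1 * e = 1.
    by rewrite -(mulrV unit_D) {3}/D; ring.
  have -> : f * D^-1 * d + - d * D^-1 * f = 0 by ring.
  by rewrite christoffel_mx1_10 // mulmx1.
split.
- exists (m^-1)%g, (f * D^-1), (- d * D^-1); split=> //.
  rewrite -subr_eq0 -mulrBl opprK /f subrK mulf_neq0 ?invr_neq0 //.
    by apply: contraTneq unit_D => S0; rewrite DE S0 mulr0 unitr0.
  by apply: contraTneq unit_D => ->; rewrite unitr0.
- by exists c, d; rewrite prod10 /c -subr_eq0 [d + _]addrC addrK subr_eq0.
- by exists e, f; rewrite prod01 /e eq_sym -subr_eq0 opprB addrC subrK subr_eq0.
move=> c' d' e' f'; rewrite prod10 prod01.
move=> /(christoffel_mx1_inj hn)[<- <-] /(christoffel_mx1_inj hn)[<- <-].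
by rewrite [c * f]mulrC.
Qed.
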